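(* Let $r\ge 2$. Among all admissible binary sequences $q$ containing exactly $r$ entries equal to $1$, the sum $$\sum_{i=1}^r 3^{\,r-i}\cdot 2^{\,1(i)-1}$$ attains its maximum value when $$1(i)=\left\lfloor 1+(i-1)\log_2 3\right\rfloor,\qquad i=1,\dots,r.$$
   Context: For a binary sequence $q$ with exactly $r$ ones, $1(i)$ denotes the position (counted from $1$, left to right) of the $i$-th occurrence of the digit $1$ in $q$. For $r\ge 1$ put $s(r)=\lfloor 1+r\log_2 3\rfloor$ and, for $r\ge 2$, $d(r)=s(r)-s(r-1)\in\{1,2\}$. The admissible sequences are the nodes of a rooted tree defined recursively. The only admissible sequence with $r=2$ ones is the root $1100$ (of length $s(2)=4$). For $r\ge 3$, the admissible sequences with $r$ ones are exactly those obtained from an admissible sequence $q'$ with $r-1$ ones by choosing one zero in the terminal (maximal trailing) block of zeros of $q'$ and inserting, immediately before that zero, the string ''$10$'' if $d(r)=2$, or the string ''$1$'' if $d(r)=1$. An admissible sequence with $r$ ones thus has length $s(r)$. *)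

(* Defs.v *)
From mathcomp Require Import all_boot all_order all_algebra.
From mathcomp Require Import reals exp.
Set Implicit Arguments.
Unset Strict Implicit.
Unset Printing Implicit Defensive.
Import Order.TTheory GRing.Theory Num.Theory.

Local Open Scope ring_scope.

Definition log2_3 (R : realType) : R := ln 3 / ln 2.

Definition s (R : realType) (r : nat) : int :=
  Num.floor (1 + r%:R * log2_3 R).

Definition d (R : realType) (r : nat) : int := s R r - s R r.-1.

Local Close Scope ring_scope.

(* Binary sequences are of type seq bool, with true for the digit 1. *)
Definition nb_ones (q : seq bool) : nat := count_mem true q.

Definition ones (q : seq bool) : seq nat :=
  [seq j <- iota 1 (size q) | nth false q j.-1].

(* 1(i); meaningful for 1 <= i <= nb_ones q. *)
Definition pos1 (q : seq bool) (i : nat) : nat := nth 0 (ones q) i.-1.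

(* A zero lies in the terminal block of zeros of a sequence iff every entry
   after it is a zero, so a parent sequence with a chosen zero in that block
   is u ++ nseq m.+1 false, the chosen zero being the one right after u
   (u itself may end with zeros). *)
Inductive admissible (R : realType) : seq bool -> Prop :=
| admissible_root : admissible R [:: true; true; false; false]
| admissible_insert10 (r : nat) (u : seq bool) (m : nat) :
    3 <= r ->
    admissible R (u ++ nseq m.+1 false) ->
    nb_ones (u ++ nseq m.+1 false) = r.-1 ->
    d R r = 2%R ->
    admissible R (u ++ [:: true; false] ++ nseq m.+1 false)
| admissible_insert1 (r : nat) (u : seq bool) (m : nat) :
    3 <= r ->
    admissible R (u ++ nseq m.+1 false) ->
    nb_ones (u ++ nseq m.+1 false) = r.-1 ->
    d R r = 1%R ->
    admissible R (u ++ [:: true] ++ nseq m.+1 false).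

Definition weighted_sum (r : nat) (q : seq bool) : nat :=
  \sum_(1 <= i < r.+1) 3 ^ (r - i) * 2 ^ (pos1 q i - 1).

Definition max_positions (R : realType) (r : nat) (q : seq bool) : Prop :=
  forall i : nat, 1 <= i <= r ->
    Posz (pos1 q i) = Num.floor (1 + (i - 1)%:R * log2_3 R)%R.

(* Main.v *)
Require Import Defs.
From mathcomp Require Import all_boot all_order all_algebra.
From mathcomp Require Import reals exp.
From mathcomp Require Import zify lra.

(** The ones of a sequence never move once they have been inserted: each step
    of the tree puts a single new one to the right of all previous ones, and
    only zeros follow it.  If the parent [u ++ nseq m.+1 false] has [r - 1]
    ones, its length is [s (r - 1)] and the new one lands at position
    [size u + 1], which is at most that length, with equality exactly when the
    chosen zero is the last one.  Hence the [i]-th one of any admissible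
    sequence is at a position at most [s (i - 1)]
    ([admissible_size_positions]), and choosing the last zero at every step
    reaches all these bounds simultaneously ([admissible_max_exists]); this is
    possible at every level because [1 < log2 3 < 2] forces [d] to be [1] or
    [2].  The weighted sum is increasing in every position, so meeting all the
    bounds at once maximizes it. *)

Import Order.TTheory GRing.Theory Num.Theory.

(** * The lengths [s r] *)

Section Lengths.
Local Open Scope ring_scope.
Variable R : realType.

(** The two bounds are the inequalities [2 ^ 3 <= 3 ^ 2] and [3 < 2 ^ 2]; a
    lower bound of [1] would not suffice to see that the root has length
    [s 2 = 4]. *)
Lemma log2_3_bounds : 3 / 2 <= log2_3 R < 2.
Proof.
have ln2_gt0 : 0 < ln (2 : R) by apply: ln_gt0; lra.
rewrite /log2_3 ler_pdivlMr // ltr_pdivrMr //.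
have le_8_9 : ln (2 ^+ 3 : R) <= ln (3 ^+ 2).
  by rewrite ler_ln ?posrE ?exprn_gt0 //; lra.
have lt_3_4 : ln (3 : R) < ln (2 ^+ 2).
  by rewrite ltr_ln ?posrE ?exprn_gt0 //; lra.
rewrite !lnXn // in le_8_9 lt_3_4.
by apply/andP; split; lra.
Qed.

Lemma s0 : s R 0 = 1.
Proof. by apply: floor_def; rewrite mul0r; lra. Qed.

Lemma s1 : s R 1 = 2.
Proof. by apply: floor_def; have /andP[] := log2_3_bounds; lra. Qed.

Lemma s2 : s R 2 = 4.
Proof. by apply: floor_def; have /andP[] := log2_3_bounds; lra. Qed.

Lemma d_eq1_or_2 (r : nat) : d R r.+1 = 1 \/ d R r.+1 = 2.
Proof.
have /andP[log_ge log_lt] := log2_3_bounds.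
have rS : r.+1%:R = r%:R + 1 :> R by rewrite -natr1.
have le_s : s R r + 1 <= s R r.+1.
  rewrite /s floor_ge_int rS intrD.
  have := floor_le (1 + r%:R * log2_3 R); lra.
have lt_s : s R r.+1 < s R r + 3.
  rewrite /s floor_lt_int rS intrD.
  have := floorD1_gt (1 + r%:R * log2_3 R); rewrite intrD; lra.
by rewrite /d /=; lia.
Qed.

End Lengths.

(** * Positions of the ones *)

Lemma ones_cat (u v : seq bool) :
  ones (u ++ v) = ones u ++ [seq size u + j | j <- ones v].
Proof.
rewrite /ones size_cat iotaD filter_cat; congr (_ ++ _).
  apply: eq_in_filter => j; rewrite mem_iota => j_range.
  by rewrite nth_cat ifT //; lia.
rewrite addnC iotaDl filter_map; congr map.
apply: eq_in_filter => j; rewrite mem_iota => j_range /=.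
rewrite nth_cat ifF; last by lia.
by congr nth; lia.
Qed.

Lemma ones_nseq_false (k : nat) : ones (nseq k false) = [::].
Proof.
rewrite /ones (eq_filter (a2 := pred0)) ?filter_pred0 // => j /=.
by rewrite nth_nseq if_same.
Qed.

Lemma ones_rcons_true (u : seq bool) (k : nat) :
  ones (u ++ true :: nseq k false) = rcons (ones u) (size u).+1.
Proof. by rewrite ones_cat -cat1s ones_cat ones_nseq_false cats1 addn1. Qed.

Lemma size_ones (q : seq bool) : size (ones q) = nb_ones q.
Proof.
elim/last_ind: q => // q b IHq.
rewrite -cats1 ones_cat size_cat size_map IHq /nb_ones count_cat.
by case: b.
Qed.

Lemma nb_ones_cat_zeros (u : seq bool) (k : nat) :
  nb_ones (u ++ nseq k false) = nb_ones u.
Proof. by rewrite /nb_ones count_cat count_nseq addn0. Qed.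

Lemma nb_ones_new_one (u : seq bool) (k : nat) :
  nb_ones (u ++ true :: nseq k false) = (nb_ones u).+1.
Proof. by rewrite -size_ones ones_rcons_true size_rcons size_ones. Qed.

Lemma pos1_cat_zeros (u : seq bool) (k i : nat) :
  pos1 (u ++ nseq k false) i = pos1 u i.
Proof. by rewrite /pos1 ones_cat ones_nseq_false cats0. Qed.

Lemma pos1_new_one (u : seq bool) (k i : nat) : 1 <= i <= (nb_ones u).+1 ->
  pos1 (u ++ true :: nseq k false) i =
    if i <= nb_ones u then pos1 u i else (size u).+1.
Proof.
move=> i_range; rewrite /pos1 ones_rcons_true nth_rcons size_ones.
case: (leqP i (nb_ones u)) => i_nb; first by rewrite ifT //; lia.
by rewrite ifF ?ifT //; lia.
Qed.

(** * Admissible sequences *)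

Section Admissible.
Variable R : realType.

Definition positions_bounded (q : seq bool) : Prop :=
  forall i : nat, 1 <= i <= nb_ones q -> (Posz (pos1 q i) <= s R (i - 1))%R.

(** Both kinds of insertion put a one followed by zeros in place of the
    terminal zeros; only the number [k] of these zeros depends on [d]. *)
Lemma insertion_size_positions (u : seq bool) (m k : nat) :
    let q := u ++ nseq m.+1 false in
    Posz (size q) = s R (nb_ones q) -> positions_bounded q ->
    (Posz k = Posz m + d R (nb_ones q).+1)%R ->
  let q' := u ++ true :: nseq k false in
  Posz (size q') = s R (nb_ones q') /\ positions_bounded q'.
Proof.
rewrite /positions_bounded /d succnK; cbv zeta.
rewrite !nb_ones_cat_zeros nb_ones_new_one.
rewrite !size_cat [size (_ :: _)]/= !size_nseq => size_q pos_q k_eq.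
split=> [|i i_range]; first by lia.
rewrite pos1_new_one //; case: leqP => i_nb.
  by have := pos_q i; rewrite pos1_cat_zeros; apply; lia.
have -> : i - 1 = nb_ones u by lia.
by lia.
Qed.

Lemma admissible_size_positions (q : seq bool) : admissible R q ->
  Posz (size q) = s R (nb_ones q) /\ positions_bounded q.
Proof.
elim=> [|r u m r_ge3 _ [size_q pos_q] nb_q d_r
        |r u m r_ge3 _ [size_q pos_q] nb_q d_r].
- split=> [|[|[|[|i]]] //= _]; first by rewrite s2.
  + by rewrite s0.
  + by rewrite s1.
- apply: (insertion_size_positions u m m.+2) => //.
  by rewrite nb_q prednK ?d_r; lia.
- apply: (insertion_size_positions u m m.+1) => //.
  by rewrite nb_q prednK ?d_r; lia.
Qed.

(** The final zero is kept explicit because it is the one chosen for the next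
    insertion, which thereby happens at position [s r]. *)
Lemma admissible_max_exists (r : nat) : 2 <= r ->
  exists u : seq bool, let q := u ++ [:: false] in
    [/\ admissible R q, nb_ones q = r & max_positions R r q].
Proof.
elim: r => // r IHr; rewrite leq_eqVlt => /predU1P[[<-]|r_ge2].
  exists [:: true; true; false]; split=> //; first exact: admissible_root.
  by move=> [|[|[|i]]] //= _;
    [rewrite -[RHS]/(s R 0) s0 | rewrite -[RHS]/(s R 1) s1].
have [u [adm_q nb_q max_q]] := IHr r_ge2.
have [size_q _] := admissible_size_positions _ adm_q.
have nb_u : nb_ones u = r by rewrite -nb_q (nb_ones_cat_zeros u 1).
have max_q' k : max_positions R r.+1 (u ++ true :: nseq k false).
  move=> i i_range; rewrite pos1_new_one nb_u //; case: leqP => i_r.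
    by rewrite -(pos1_cat_zeros u 1) max_q //; lia.
  have -> : i - 1 = r by lia.
  by rewrite -[RHS]/(s R r) -nb_q -size_q size_cat addn1.
have [d1|d2] := d_eq1_or_2 R r.
- exists (u ++ [:: true]); rewrite /= -catA.
  split; [|by rewrite (nb_ones_new_one u 1) nb_u|exact: (max_q' 1)].
  exact: (admissible_insert1 (r := r.+1) (m := 0) _ adm_q nb_q d1).
- exists (u ++ [:: true; false]); rewrite /= -catA.
  split; [|by rewrite (nb_ones_new_one u 2) nb_u|exact: (max_q' 2)].
  exact: (admissible_insert10 (r := r.+1) (m := 0) _ adm_q nb_q d2).
Qed.

End Admissible.

Lemma leq_weighted_sum (r : nat) (q q' : seq bool) :
    (forall i, 1 <= i <= r -> pos1 q i <= pos1 q' i) ->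
  weighted_sum r q <= weighted_sum r q'.
Proof.
move=> le_pos; rewrite /weighted_sum !big_nat; apply: leq_sum => i i_range.
by rewrite leq_mul2l leq_pexp2l ?orbT // leq_sub2r // le_pos.
Qed.

Theorem theorem2p4 (R : realType) (r : nat) (hr : 2 <= r) :
  (exists q : seq bool,
      [/\ admissible R q, nb_ones q = r & max_positions R r q]) /\
  (forall q : seq bool,
      admissible R q -> nb_ones q = r -> max_positions R r q ->
      forall q' : seq bool, admissible R q' -> nb_ones q' = r ->
        weighted_sum r q' <= weighted_sum r q).
Proof.
split=> [|q _ _ max_q q' adm_q' nb_q'].
  by have [u max_u] := admissible_max_exists R r hr; exists (u ++ [:: false]).
have [_ pos_q'] := admissible_size_positions R q' adm_q'.
apply: leq_weighted_sum => i i_range.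
by rewrite -lez_nat max_q //; apply: pos_q'; rewrite nb_q'.
Qed.
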